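(* For every integer $m\ge 1$, the number of arcs of ${\cal D}^*_m$, counted with multiplicity (equivalently, the sum of all entries of its adjacency matrix ${\cal T}^*_m$), equals $3^m+(-1)^m$.
   Context: Alpha-letters (2-element subsets of the directions up, down, left, right): $a=\{\text{right},\text{down}\}$, $b=\{\text{up},\text{down}\}$, $c=\{\text{right},\text{up}\}$, $d=\{\text{left},\text{down}\}$, $e=\{\text{left},\text{right}\}$, $f=\{\text{left},\text{up}\}$. ${\cal D}_{ud}$: arc $(\alpha,\beta)$ iff ($\text{down}\in\alpha\iff\text{up}\in\beta$); ${\cal D}_{lr}$: arc $(\alpha,\beta)$ iff ($\text{right}\in\alpha\iff\text{left}\in\beta$). ${\cal D}_m$: vertices are the words $\alpha_1\cdots\alpha_m\in\{a,\dots,f\}^m$ with $(\alpha_i,\alpha_{i+1})$ an arc of ${\cal D}_{ud}$ for $1\le i\le m$ ($\alpha_{m+1}:=\alpha_1$); arc $v\to u$ iff $(v_i,u_i)$ is an arc of ${\cal D}_{lr}$ for all $i$. Outlet word $o(\alpha)\in\{0,1\}^m$: $o_j=1$ iff $\alpha_j\in\{a,c,e\}$; inlet word $i(\alpha)$: $i_j=1$ iff $\alpha_j\in\{d,e,f\}$. ${\cal D}^*_m$ is the directed multigraph obtained from ${\cal D}_m$ by merging vertices with a common outlet word: vertex set $\{o(x):x\in V({\cal D}_m)\}$, and the number of arcs from $v$ to $w$ is $|\{y\in V({\cal D}_m): i(y)=v,\ o(y)=w\}|$. *)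

(* Defs.v *)
From HB Require Import structures.
From mathcomp Require Import all_boot all_order all_algebra.

Set Implicit Arguments.
Unset Strict Implicit.
Unset Printing Implicit Defensive.

Inductive direction := Up | Down | Left | Right.

Definition nat_of_direction (x : direction) : nat :=
  match x with Up => 0 | Down => 1 | Left => 2 | Right => 3 end.
Definition direction_of_nat (n : nat) : option direction :=
  match n with
  | 0 => Some Up | 1 => Some Down | 2 => Some Left | 3 => Some Right
  | _ => None
  end.
Lemma nat_of_directionK : pcancel nat_of_direction direction_of_nat.
Proof. by case. Qed.
HB.instance Definition _ := Countable.copy direction (pcan_type nat_of_directionK).
Lemma direction_enumP : Finite.axiom [:: Up; Down; Left; Right].
Proof. by case. Qed.
HB.instance Definition _ := isFinite.Build direction direction_enumP.

Inductive letter := La | Lb | Lc | Ld | Le | Lf.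

Definition nat_of_letter (x : letter) : nat :=
  match x with La => 0 | Lb => 1 | Lc => 2 | Ld => 3 | Le => 4 | Lf => 5 end.
Definition letter_of_nat (n : nat) : option letter :=
  match n with
  | 0 => Some La | 1 => Some Lb | 2 => Some Lc
  | 3 => Some Ld | 4 => Some Le | 5 => Some Lf
  | _ => None
  end.
Lemma nat_of_letterK : pcancel nat_of_letter letter_of_nat.
Proof. by case. Qed.
HB.instance Definition _ := Countable.copy letter (pcan_type nat_of_letterK).
Lemma letter_enumP : Finite.axiom [:: La; Lb; Lc; Ld; Le; Lf].
Proof. by case. Qed.
HB.instance Definition _ := isFinite.Build letter letter_enumP.

Definition dirs (x : letter) : {set direction} :=
  match x with
  | La => [set Right; Down]
  | Lb => [set Up; Down]
  | Lc => [set Right; Up]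
  | Ld => [set Left; Down]
  | Le => [set Left; Right]
  | Lf => [set Left; Up]
  end.

Lemma dirs_inj : injective dirs.
Proof.
move=> x y /setP E; move: (E Up) (E Down) (E Left) (E Right).
by case: x {E}; case: y; rewrite /= !inE.
Qed.

Lemma dirs_codom : dirs @: [set: letter] = [set A : {set direction} | #|A| == 2].
Proof.
apply/eqP; rewrite eqEcard; apply/andP; split.
  by apply/subsetP => A /imsetP[[] _ ->]; rewrite inE cards2.
rewrite (card_draws direction 2) card_imset ?cardsT; last exact: dirs_inj.
by rewrite !cardT !enumT !unlock.
Qed.

Record digraph := Digraph { vertex :> finType; arc : rel vertex }.

Record multidigraph := MultiDigraph {
  mvertex :> finType;
  mult : mvertex -> mvertex -> nat
}.

Definition D_ud : digraph :=
  @Digraph letter (fun x y => (Down \in dirs x) == (Up \in dirs y)).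

Definition D_lr : digraph :=
  @Digraph letter (fun x y => (Right \in dirs x) == (Left \in dirs y)).

(* [ordS i] is [i.+1 %% m], so the last letter is compared with the first. *)
Definition is_column (m : nat) (w : m.-tuple letter) : bool :=
  [forall i : 'I_m, @arc D_ud (tnth w i) (tnth w (ordS i))].

Definition D_col (m : nat) : digraph :=
  @Digraph {w : m.-tuple letter | is_column w}
    (fun v u => [forall i : 'I_m, @arc D_lr (tnth (val v) i) (tnth (val u) i)]).

(* Binary words are boolean tuples, with [true] standing for the digit 1. *)
Definition outlet (m : nat) (w : m.-tuple letter) : m.-tuple bool :=
  [tuple tnth w j \in [:: La; Lc; Le] | j < m].

Definition inlet (m : nat) (w : m.-tuple letter) : m.-tuple bool :=
  [tuple tnth w j \in [:: Ld; Le; Lf] | j < m].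

Definition is_outlet_word (m : nat) (s : m.-tuple bool) : bool :=
  [exists x : D_col m, s == outlet (val x)].

Definition Dstar (m : nat) : multidigraph :=
  @MultiDigraph {s : m.-tuple bool | is_outlet_word s}
    (fun v w => #|[set y : D_col m | (inlet (val y) == val v)
                               & (outlet (val y) == val w)]|).

Definition num_arcs (G : multidigraph) : nat :=
  \sum_(v : G) \sum_(w : G) mult v w.

Definition adjacency_mx (G : multidigraph) : 'M[int]_#|G| :=
  (\matrix_(i, j) (mult (enum_val i) (enum_val j))%:Z)%R.

Definition Tstar (m : nat) : 'M[int]_#|Dstar m| := adjacency_mx (Dstar m).

Lemma arc_D_colE (m : nat) (v u : D_col m) :
  arc v u = (outlet (val v) == inlet (val u)).
Proof.
apply/forallP/eqP => [H | E i].
  apply: eq_from_tnth => i; rewrite !tnth_mktuple.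
  move: (H i); rewrite /arc /=.
  by case: (tnth _ _); case: (tnth _ _); rewrite /= !inE.
move: (congr1 (fun t => tnth t i) E); rewrite !tnth_mktuple /arc /=.
by case: (tnth _ _); case: (tnth _ _); rewrite /= !inE.
Qed.

(* Main.v *)
Require Import Defs.
From HB Require Import structures.
From mathcomp Require Import all_boot all_order all_algebra.
From mathcomp Require Import ring.
Import Order.TTheory GRing.Theory Num.Theory.
Local Open Scope ring_scope.

(** Exchanging left and right turns inlet words into outlet words, so every
    inlet word is a vertex of [Dstar m] and the arcs of [Dstar m] are in bijection
    with the vertices of [D_col m].  These are the closed walks of length [m] in the
    multigraph on the two states "up" / "not up" in which a letter is an arc from
    its "up" bit to its "down" bit.  Its adjacency matrix is [[1, 2], [2, 1]],
    with eigenvalues 3 and -1. *)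

Definition mirror (x : letter) : letter :=
  match x with
  | La => Ld | Lb => Lb | Lc => Lf | Ld => La | Le => Le | Lf => Lc
  end.

(** Columns depend only on [Up] and [Down], which [mirror] leaves unchanged in every letter. *)
Lemma is_column_mirror {m} {w : m.-tuple letter} :
  is_column w -> is_column (map_tuple mirror w).
Proof.
move=> /forallP H; apply/forallP => i; move: (H i); rewrite /arc /= !tnth_map.
by case: (tnth w i); case: (tnth w (ordS i)); rewrite /= !inE.
Qed.

Lemma outlet_mirror m (w : m.-tuple letter) :
  outlet (map_tuple mirror w) = inlet w.
Proof.
apply: eq_from_tnth => i; rewrite !tnth_mktuple tnth_map.
by case: (tnth w i).
Qed.

Lemma is_outlet_word_outlet {m} (y : D_col m) : is_outlet_word (outlet (val y)).
Proof. by apply/existsP; exists y. Qed.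

Lemma is_outlet_word_inlet {m} (y : D_col m) : is_outlet_word (inlet (val y)).
Proof.
apply/existsP; exists (Sub (map_tuple mirror (val y)) (is_column_mirror (valP y))).
by rewrite SubK outlet_mirror.
Qed.

Definition head_vertex {m} (y : D_col m) : Dstar m :=
  Sub (outlet (val y)) (is_outlet_word_outlet y).

Definition tail_vertex {m} (y : D_col m) : Dstar m :=
  Sub (inlet (val y)) (is_outlet_word_inlet y).

(** The multiplicities are the sizes of the fibres of [y |-> (tail_vertex y, head_vertex y)], which
    partition [D_col m]. *)
Lemma num_arcs_Dstar m : num_arcs (Dstar m) = #|D_col m|.
Proof.
rewrite /num_arcs pair_big /= -sum1_card.
rewrite (partition_big (fun y : D_col m => (tail_vertex y, head_vertex y))
  predT) //=.
apply: eq_bigr => -[v w] _; rewrite -sum1_card.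
by apply: eq_bigl => y; rewrite inE xpair_eqE -!val_eqE.
Qed.

Lemma sum_adjacency_mx (G : multidigraph) :
  \sum_i \sum_j adjacency_mx G i j = (num_arcs G)%:Z.
Proof.
rewrite /num_arcs (big_morph Posz PoszD (erefl _))
  (reindex _ (onW_bij _ (@enum_val_bij G))) /=.
apply: eq_bigr => i _.
rewrite (big_morph Posz PoszD (erefl _))
  (reindex _ (onW_bij _ (@enum_val_bij G))) /=.
by apply: eq_bigr => j _; rewrite mxE.
Qed.

Definition has_up (x : letter) : bool := Up \in dirs x.
Definition has_down (x : letter) : bool := Down \in dirs x.

(** The shifted equality makes [s] the up bit of the first letter, each down bit the next up bit,
    and [t] the last down bit; the empty walk forces [s = t]. *)
Definition walk (s t : bool) (w : seq letter) : bool :=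
  s :: map has_down w == rcons (map has_up w) t.

Lemma walk_cons s t x w :
  walk s t (x :: w) = (s == has_up x) && walk (has_down x) t w.
Proof. by rewrite /walk /= eqseq_cons. Qed.

Lemma is_column_cons n x (w : n.-tuple letter) :
  is_column [tuple of x :: w] = walk (has_down x) (has_up x) w.
Proof.
have E (i : 'I_n.+1) : has_up (tnth [tuple of x :: w] (ordS i)) =
    nth false (rcons (map has_up w) (has_up x)) i.
  rewrite (tnth_nth x) /= nth_rcons size_map size_tuple.
  have := ltn_ord i; rewrite ltnS leq_eqVlt.
  (* At [i = n] the successor [ordS i] wraps around to 0, and the letter there is [x]. *)
  case: eqP => [-> _ | _ /= lt_in]; first by rewrite ltnn modnn.
  by rewrite lt_in modn_small ?ltnS //= (nth_map x) ?size_tuple.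
have F (i : 'I_n.+1) : has_down (tnth [tuple of x :: w] i) =
    nth false (map has_down (x :: w)) i.
  by rewrite (tnth_nth x) (nth_map x) //= size_tuple.
apply/forallP/eqP => [H | H i].
  apply: (@eq_from_nth _ false); first by rewrite size_rcons /= !size_map.
  move=> i; rewrite /= size_map size_tuple => lt_in.
  by have /eqP := H (Ordinal lt_in); rewrite -/(has_down _) -/(has_up _) E F.
by apply/eqP; rewrite -/(has_down _) -/(has_up _) E F /= H.
Qed.

Lemma big_tuple_cons (T : finType) (n : nat) (V : nmodType)
    (F : n.+1.-tuple T -> V) :
  \sum_(w : n.+1.-tuple T) F w =
  \sum_(x : T) \sum_(w : n.-tuple T) F [tuple of x :: w].
Proof.
rewrite pair_big /=.
rewrite (reindex (fun p : T * n.-tuple T => [tuple of p.1 :: p.2])) //=.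
exists (fun w => (thead w, [tuple of behead w])) => [[x w] _ | w _] /=.
  by congr pair; apply: val_inj.
by rewrite [RHS]tuple_eta.
Qed.

Lemma big_letter (V : nmodType) (F : letter -> V) :
  \sum_x F x = F La + F Lb + F Lc + F Ld + F Le + F Lf.
Proof.
rewrite -big_enum (_ : enum _ = [:: La; Lb; Lc; Ld; Le; Lf]).
  by rewrite !big_cons big_nil /= addr0 !addrA.
by rewrite enumT unlock.
Qed.

(** These are the entries of the n-th power of [[1, 2], [2, 1]], doubled to avoid dividing by 2 in
    the integers. *)
Lemma sum_walk n s t :
  (\sum_(w : n.-tuple letter) (walk s t w)%:Z) *+ 2 =
  3 ^+ n + (-1) ^+ (s != t) * (-1) ^+ n.
Proof.
elim: n s t => [|n IHn] s t.
  rewrite (bigD1 [tuple]) //= big1 => [|w]; last by rewrite [w]tuple0 => /eqP.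
  by case: s; case: t.
rewrite big_tuple_cons.
have E x : \sum_(w : n.-tuple letter) (walk s t [tuple of x :: w])%:Z =
    (s == has_up x)%:R * \sum_(w : n.-tuple letter) (walk (has_down x) t w)%:Z.
  rewrite mulr_sumr; apply: eq_bigr => w _.
  by rewrite walk_cons; case: (s == _); rewrite ?mul1r ?mul0r.
under eq_bigr do rewrite E.
rewrite big_letter /has_up /has_down /= !inE /=.
have := IHn true t; have := IHn false t.
set T := \sum_(w : n.-tuple letter) (walk true t w)%:Z.
set F := \sum_(w : n.-tuple letter) (walk false t w)%:Z.
(* From either state, one letter keeps the state and two letters change it. *)
move=> HF HT; rewrite [RHS](_ : _ = if s then (T *+ 2) + (F *+ 2) *+ 2
                                    else (F *+ 2) + (T *+ 2) *+ 2).
  by case: s {E} => /=; ring.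
by rewrite HF HT !exprS; case: s {E}; case: t {IHn T F HF HT} => /=; ring.
Qed.

(** A positive length provides a first letter at which to cut the closed walk; at length 0 the count
    is 1, whereas the formula would give 2. *)
Lemma card_D_col n : #|D_col n.+1|%:Z = 3 ^+ n.+1 + (-1) ^+ n.+1.
Proof.
have -> : #|D_col n.+1|%:Z = \sum_(w : n.+1.-tuple letter) (is_column w)%:Z.
  rewrite card_sig -sum1_card (big_morph Posz PoszD (erefl _)) big_mkcond /=.
  by apply: eq_bigr => w _; rewrite unfold_in; case: (is_column w).
rewrite big_tuple_cons.
under eq_bigr do under eq_bigr do rewrite is_column_cons.
rewrite big_letter /has_up /has_down /= !inE /=.
(* After doubling, [Lb] and [Le], whose two bits agree, give 3^n + (-1)^n each, and the other four
   letters give 3^n - (-1)^n each. *)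
apply: (@pmulrnI _ 2) => //.
rewrite !mulrnDl !sum_walk !exprS /=; ring.
Qed.

Theorem theorem4 (m : nat) (hm : (1 <= m)%N) :
  (num_arcs (Dstar m))%:Z = 3 ^+ m + (-1) ^+ m /\
  \sum_i \sum_j Tstar m i j = 3 ^+ m + (-1) ^+ m.
Proof.
rewrite sum_adjacency_mx num_arcs_Dstar.
by case: m hm => // n _; rewrite card_D_col.
Qed.
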